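(* Let $P$ be a CP term and $\Gamma$ an environment. If $\vdash P:\Gamma$ in CP, then $\vdash [\![P]\!]:\Gamma$ in HCP.
   Context: Session types: $A,B ::= A\otimes B \mid \mathbf{1} \mid A ⅋ B \mid \bot \mid A\oplus B \mid \mathbf{0} \mid A \& B \mid \top$, with duality the involution $(A\otimes B)^\bot = A^\bot ⅋ B^\bot$, $(A ⅋ B)^\bot = A^\bot\otimes B^\bot$, $\mathbf{1}^\bot=\bot$, $\bot^\bot=\mathbf{1}$, $(A\oplus B)^\bot = A^\bot \& B^\bot$, $(A\& B)^\bot = A^\bot\oplus B^\bot$, $\mathbf{0}^\bot=\top$, $\top^\bot=\mathbf{0}$. An environment is a finite list $x_1:A_1,\dots,x_n:A_n$ of pairwise distinct names with types; $\Gamma,\Delta$ requires disjoint names. A hyper-environment is a finite multiset $\Gamma_1\mid\dots\mid\Gamma_n$ of environments (empty: $\varnothing$); names may be shared between its environments. CP terms: $P,Q ::= x\leftrightarrow y \mid \nu x(P\parallel Q)$ (cut; $x$ bound in $P$ and $Q$) $\mid x[y](P\parallel Q)$ (output; $y$ bound in $P$, $x$ continues in $Q$) $\mid x(y).P$ ($y$ bound in $P$) $\mid x[].0$ (halt) $\mid x().P$ (wait) $\mid x\triangleleft\mathrm{inl}.P\mid x\triangleleft\mathrm{inr}.P\mid x\triangleright\{\mathrm{inl}:P;\mathrm{inr}:Q\}\mid x\triangleright\{\}$. CP typing $\vdash P:\Gamma$: (Ax) $\vdash x\leftrightarrow y:x:A,y:A^\bot$; (Cut) from $\vdash P:\Gamma,x:A$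 and $\vdash Q:\Delta,x:A^\bot$ infer $\vdash \nu x(P\parallel Q):\Gamma,\Delta$; ($\otimes$) from $\vdash P:\Gamma,y:A$ and $\vdash Q:\Delta,x:B$ infer $\vdash x[y](P\parallel Q):\Gamma,\Delta,x:A\otimes B$; ($⅋$) from $\vdash P:\Gamma,y:A,x:B$ infer $\vdash x(y).P:\Gamma,x:A⅋B$; ($\mathbf{1}$) $\vdash x[].0:x:\mathbf{1}$; ($\bot$) from $\vdash P:\Gamma$ infer $\vdash x().P:\Gamma,x:\bot$; ($\oplus_1$) from $\vdash P:\Gamma,x:A$ infer $\vdash x\triangleleft\mathrm{inl}.P:\Gamma,x:A\oplus B$; ($\oplus_2$) from $\vdash P:\Gamma,x:B$ infer $\vdash x\triangleleft\mathrm{inr}.P:\Gamma,x:A\oplus B$; ($\&$) from $\vdash P:\Gamma,x:A$ and $\vdash Q:\Gamma,x:B$ infer $\vdash x\triangleright\{\mathrm{inl}:P;\mathrm{inr}:Q\}:\Gamma,x:A\&B$; ($\top$) $\vdash x\triangleright\{\}:\Gamma,x:\top$; no rule for $\mathbf{0}$. HCP terms: $P,Q,R ::= x\leftrightarrow y \mid 0 \mid (\nu x)P$ (binds $x$) $\mid (P \mid Q) \mid x[y].P$ ($y$ bound in $P$) $\mid x(y).P$ ($y$ bound in $P$) $\mid x[].P \mid x().P \mid x\triangleleft \mathrm{inl}.P \mid x\triangleleft\mathrm{inr}.P \mid x\triangleright\{\mathrm{inl}:P;\mathrm{inr}:Q\} \mid x\triangleright\{\}$. HCP typing $\vdash P:\mathcal{G}$: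 (Ax) $\vdash x\leftrightarrow y : x:A, y:A^\bot$. (H-Cut) from $\vdash P:\mathcal{G}\mid \Gamma, x:A \mid \Delta, x:A^\bot$ infer $\vdash (\nu x)P : \mathcal{G}\mid \Gamma,\Delta$. (H-Mix) from $\vdash P:\mathcal{G}$, $\vdash Q:\mathcal{H}$ infer $\vdash (P\mid Q): \mathcal{G}\mid\mathcal{H}$. (H-Mix$_0$) $\vdash 0:\varnothing$. ($\otimes$) from $\vdash P : \mathcal{G}\mid \Gamma, y:A \mid \Delta, x:B$ infer $\vdash x[y].P : \mathcal{G}\mid\Gamma,\Delta,x:A\otimes B$. ($⅋$) from $\vdash P : \mathcal{G}\mid\Gamma, y:A, x:B$ infer $\vdash x(y).P : \mathcal{G}\mid\Gamma, x:A⅋B$. ($\mathbf{1}$) from $\vdash P:\mathcal{G}$ infer $\vdash x[].P : \mathcal{G}\mid x:\mathbf{1}$. ($\bot$) from $\vdash P:\mathcal{G}\mid\Gamma$ infer $\vdash x().P : \mathcal{G}\mid\Gamma,x:\bot$. ($\oplus_1$) from $\vdash P:\mathcal{G}\mid\Gamma,x:A$ infer $\vdash x\triangleleft\mathrm{inl}.P:\mathcal{G}\mid\Gamma,x:A\oplus B$; ($\oplus_2$) analogously with $\mathrm{inr}$ and $x:B$. ($\&$) from $\vdash P:\Gamma,x:A$ and $\vdash Q:\Gamma,x:B$ infer $\vdash x\triangleright\{\mathrm{inl}:P;\mathrm{inr}:Q\}:\Gamma,x:A\&B$. ($\top$) $\vdash x\triangleright\{\}:\Gamma,x:\top$. No rule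 for $\mathbf{0}$. Each logical rule ($\otimes,⅋,\mathbf{1},\bot,\oplus_1,\oplus_2$) has the side condition that $x$ does not occur in $\mathcal{G}$. The translation $[\![\cdot]\!]$ from CP to HCP terms: $[\![x\leftrightarrow y]\!]=x\leftrightarrow y$; $[\![\nu x(P\parallel Q)]\!]=(\nu x)([\![P]\!]\mid[\![Q]\!])$; $[\![x[y](P\parallel Q)]\!]=x[y].([\![P]\!]\mid[\![Q]\!])$; $[\![x(y).P]\!]=x(y).[\![P]\!]$; $[\![x[].0]\!]=x[].0$; $[\![x().P]\!]=x().[\![P]\!]$; $[\![x\triangleleft\mathrm{inl}.P]\!]=x\triangleleft\mathrm{inl}.[\![P]\!]$; $[\![x\triangleleft\mathrm{inr}.P]\!]=x\triangleleft\mathrm{inr}.[\![P]\!]$; $[\![x\triangleright\{\mathrm{inl}:P;\mathrm{inr}:Q\}]\!]=x\triangleright\{\mathrm{inl}:[\![P]\!];\mathrm{inr}:[\![Q]\!]\}$; $[\![x\triangleright\{\}]\!]=x\triangleright\{\}$. *)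

(* Defs.v *)
From Stdlib Require Import List Permutation.
Import ListNotations.

Inductive ty : Type :=
| Tensor (A B : ty)
| One
| Par (A B : ty)
| Bot
| Plus (A B : ty)
| Zero
| With (A B : ty)
| Top.

Fixpoint dual (A : ty) : ty :=
  match A with
  | Tensor A B => Par (dual A) (dual B)
  | One => Bot
  | Par A B => Tensor (dual A) (dual B)
  | Bot => One
  | Plus A B => With (dual A) (dual B)
  | Zero => Top
  | With A B => Plus (dual A) (dual B)
  | Top => Zero
  end.

Definition name := nat.

(* Lists are representatives: the order of an environment, and the order of the
   environments in a hyper-environment, are made irrelevant by the exchange
   rules [CP_Exch] and [HCP_Exch].  The empty hyper-environment [[]] differs
   from [[[]]], which consists of one empty environment. *)
Definition env := list (name * ty).
Definition henv := list env.

Definition env_names (Γ : env) : list name := map fst Γ.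
Definition env_wf (Γ : env) : Prop := NoDup (env_names Γ).

Definition not_in_henv (x : name) (G : henv) : Prop :=
  Forall (fun Γ => ~ In x (env_names Γ)) G.

Definition henv_eq (G H : henv) : Prop :=
  exists G', Permutation G G' /\ Forall2 (@Permutation (name * ty)) G' H.

Inductive cp : Type :=
| CLink (x y : name)               (* x <-> y *)
| CCut (x : name) (P Q : cp)       (* nu x (P || Q), x bound in P and Q *)
| COut (x y : name) (P Q : cp)     (* x[y](P || Q), y bound in P only *)
| CIn (x y : name) (P : cp)        (* x(y).P, y bound in P *)
| CHalt (x : name)                 (* x[].0 *)
| CWait (x : name) (P : cp)        (* x().P *)
| CInl (x : name) (P : cp)
| CInr (x : name) (P : cp)
| CCase (x : name) (P Q : cp)      (* x |> {inl: P; inr: Q} *)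
| CAbsurd (x : name).              (* x |> {} *)

(* Terms are raw named terms.  [env_wf] is required only where it does not
   follow from the premises: every derivable environment is well formed, see
   [cp_typed_wf]. *)
Inductive cp_typed : cp -> env -> Prop :=
| CP_Ax x y A :
    env_wf [(x, A); (y, dual A)] ->
    cp_typed (CLink x y) [(x, A); (y, dual A)]
| CP_Cut x A P Q Γ Δ :
    cp_typed P (Γ ++ [(x, A)]) ->
    cp_typed Q (Δ ++ [(x, dual A)]) ->
    env_wf (Γ ++ Δ) ->
    cp_typed (CCut x P Q) (Γ ++ Δ)
| CP_Tensor x y A B P Q Γ Δ :
    cp_typed P (Γ ++ [(y, A)]) ->
    cp_typed Q (Δ ++ [(x, B)]) ->
    env_wf (Γ ++ Δ ++ [(x, Tensor A B)]) ->
    cp_typed (COut x y P Q) (Γ ++ Δ ++ [(x, Tensor A B)])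
| CP_Par x y A B P Γ :
    cp_typed P (Γ ++ [(y, A); (x, B)]) ->
    cp_typed (CIn x y P) (Γ ++ [(x, Par A B)])
| CP_One x :
    cp_typed (CHalt x) [(x, One)]
| CP_Bot x P Γ :
    cp_typed P Γ ->
    env_wf (Γ ++ [(x, Bot)]) ->
    cp_typed (CWait x P) (Γ ++ [(x, Bot)])
| CP_Plus1 x A B P Γ :
    cp_typed P (Γ ++ [(x, A)]) ->
    cp_typed (CInl x P) (Γ ++ [(x, Plus A B)])
| CP_Plus2 x A B P Γ :
    cp_typed P (Γ ++ [(x, B)]) ->
    cp_typed (CInr x P) (Γ ++ [(x, Plus A B)])
| CP_With x A B P Q Γ :
    cp_typed P (Γ ++ [(x, A)]) ->
    cp_typed Q (Γ ++ [(x, B)]) ->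
    cp_typed (CCase x P Q) (Γ ++ [(x, With A B)])
| CP_Top x Γ :
    env_wf (Γ ++ [(x, Top)]) ->
    cp_typed (CAbsurd x) (Γ ++ [(x, Top)])
| CP_Exch P Γ Δ :
    Permutation Γ Δ ->
    cp_typed P Γ ->
    cp_typed P Δ.

Inductive hcp : Type :=
| HLink (x y : name)               (* x <-> y *)
| HNil                             (* 0 *)
| HNu (x : name) (P : hcp)         (* (nu x) P, x bound in P *)
| HMix (P Q : hcp)                 (* P | Q *)
| HOut (x y : name) (P : hcp)      (* x[y].P, y bound in P *)
| HIn (x y : name) (P : hcp)       (* x(y).P, y bound in P *)
| HHalt (x : name) (P : hcp)       (* x[].P *)
| HWait (x : name) (P : hcp)       (* x().P *)
| HInl (x : name) (P : hcp)
| HInr (x : name) (P : hcp)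
| HCase (x : name) (P Q : hcp)     (* x |> {inl: P; inr: Q} *)
| HAbsurd (x : name).              (* x |> {} *)

Inductive hcp_typed : hcp -> henv -> Prop :=
| HCP_Ax x y A :
    env_wf [(x, A); (y, dual A)] ->
    hcp_typed (HLink x y) [[(x, A); (y, dual A)]]
| HCP_Cut x A P G Γ Δ :
    hcp_typed P (G ++ [Γ ++ [(x, A)]; Δ ++ [(x, dual A)]]) ->
    env_wf (Γ ++ Δ) ->
    hcp_typed (HNu x P) (G ++ [Γ ++ Δ])
| HCP_Mix P Q G H :
    hcp_typed P G ->
    hcp_typed Q H ->
    hcp_typed (HMix P Q) (G ++ H)
| HCP_Mix0 :
    hcp_typed HNil []
| HCP_Tensor x y A B P G Γ Δ :
    hcp_typed P (G ++ [Γ ++ [(y, A)]; Δ ++ [(x, B)]]) ->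
    not_in_henv x G ->
    env_wf (Γ ++ Δ ++ [(x, Tensor A B)]) ->
    hcp_typed (HOut x y P) (G ++ [Γ ++ Δ ++ [(x, Tensor A B)]])
| HCP_Par x y A B P G Γ :
    hcp_typed P (G ++ [Γ ++ [(y, A); (x, B)]]) ->
    not_in_henv x G ->
    hcp_typed (HIn x y P) (G ++ [Γ ++ [(x, Par A B)]])
| HCP_One x P G :
    hcp_typed P G ->
    not_in_henv x G ->
    hcp_typed (HHalt x P) (G ++ [[(x, One)]])
| HCP_Bot x P G Γ :
    hcp_typed P (G ++ [Γ]) ->
    not_in_henv x G ->
    env_wf (Γ ++ [(x, Bot)]) ->
    hcp_typed (HWait x P) (G ++ [Γ ++ [(x, Bot)]])
| HCP_Plus1 x A B P G Γ :
    hcp_typed P (G ++ [Γ ++ [(x, A)]]) ->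
    not_in_henv x G ->
    hcp_typed (HInl x P) (G ++ [Γ ++ [(x, Plus A B)]])
| HCP_Plus2 x A B P G Γ :
    hcp_typed P (G ++ [Γ ++ [(x, B)]]) ->
    not_in_henv x G ->
    hcp_typed (HInr x P) (G ++ [Γ ++ [(x, Plus A B)]])
| HCP_With x A B P Q Γ :
    hcp_typed P [Γ ++ [(x, A)]] ->
    hcp_typed Q [Γ ++ [(x, B)]] ->
    hcp_typed (HCase x P Q) [Γ ++ [(x, With A B)]]
| HCP_Top x Γ :
    env_wf (Γ ++ [(x, Top)]) ->
    hcp_typed (HAbsurd x) [Γ ++ [(x, Top)]]
| HCP_Exch P G H :
    henv_eq G H ->
    hcp_typed P G ->
    hcp_typed P H.

Fixpoint translate (P : cp) : hcp :=
  match P with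
  | CLink x y => HLink x y
  | CCut x P Q => HNu x (HMix (translate P) (translate Q))
  | COut x y P Q => HOut x y (HMix (translate P) (translate Q))
  | CIn x y P => HIn x y (translate P)
  | CHalt x => HHalt x HNil
  | CWait x P => HWait x (translate P)
  | CInl x P => HInl x (translate P)
  | CInr x P => HInr x (translate P)
  | CCase x P Q => HCase x (translate P) (translate Q)
  | CAbsurd x => HAbsurd x
  end.

Lemma env_wf_retype (Γ : env) (x : name) (A B : ty) :
  env_wf (Γ ++ [(x, A)]) -> env_wf (Γ ++ [(x, B)]).
Proof. unfold env_wf, env_names; rewrite !map_app; exact (fun h => h). Qed.

Lemma env_wf_drop (Γ : env) (x y : name) (A B C : ty) :
  env_wf (Γ ++ [(y, A); (x, B)]) -> env_wf (Γ ++ [(x, C)]).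
Proof.
unfold env_wf, env_names; rewrite !map_app; simpl; apply NoDup_remove_1.
Qed.

Lemma env_wf_perm (Γ Δ : env) : Permutation Γ Δ -> env_wf Γ -> env_wf Δ.
Proof.
intros h; apply Permutation_NoDup; unfold env_names; now apply Permutation_map.
Qed.

Lemma env_wf_single (x : name) (A : ty) : env_wf [(x, A)].
Proof. repeat constructor; intros []. Qed.

Lemma cp_typed_wf (P : cp) (Γ : env) : cp_typed P Γ -> env_wf Γ.
Proof.
induction 1; try apply env_wf_single;
  try assumption;
  first [eapply env_wf_retype; eassumption | eapply env_wf_drop; eassumption
        | eapply env_wf_perm; eassumption].
Qed.

Lemma henv_eq_wf (G H : henv) :
  henv_eq G H -> Forall env_wf G -> Forall env_wf H.
Proof.
intros [G' [hp hf]] hG; apply (Permutation_Forall hp) in hG; clear hp.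
induction hf; inversion hG; constructor; eauto using env_wf_perm.
Qed.

Lemma hcp_typed_wf (P : hcp) (G : henv) : hcp_typed P G -> Forall env_wf G.
Proof.
induction 1;
  repeat rewrite Forall_app in *; repeat rewrite Forall_cons_iff in *;
  intuition (try apply env_wf_single; try apply Forall_nil);
  first [eapply env_wf_retype; eassumption | eapply env_wf_drop; eassumption
        | eapply henv_eq_wf; eassumption].
Qed.

(* Main.v *)
Require Import Defs.
From Stdlib Require Import List Permutation.
Import ListNotations.

(** By induction on the CP derivation: each CP rule is the HCP rule of the same name over an empty
    ambient [G], so freshness of [x] in [G] is vacuous. *)

Lemma hcp_typed_perm (P : hcp) (Γ Δ : env) :
  Permutation Γ Δ -> hcp_typed P [Γ] -> hcp_typed P [Δ].
Proof.
intros h; apply HCP_Exch; exists [Γ]; split; auto.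
Qed.

Theorem theorem28 (P : cp) (Γ : env) :
  cp_typed P Γ -> hcp_typed (translate P) [Γ].
Proof.
induction 1; simpl.
- now apply HCP_Ax.
(* Mix puts the two premises side by side as the two environments that [HCP_Cut], and likewise
   [HCP_Tensor], joins. *)
- apply (HCP_Cut x A _ []); [exact (HCP_Mix _ _ _ _ IHcp_typed1 IHcp_typed2) | assumption].
- apply (HCP_Tensor x y A B _ []);
    [exact (HCP_Mix _ _ _ _ IHcp_typed1 IHcp_typed2) | constructor | assumption].
- apply (HCP_Par x y A B _ []); [assumption | constructor].
(* The continuation [HNil] is typed by [HCP_Mix0]. *)
- apply (HCP_One x _ []); constructor.
- apply (HCP_Bot x _ []); [assumption | constructor | assumption].
- apply (HCP_Plus1 x A B _ []); [assumption | constructor].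
- apply (HCP_Plus2 x A B _ []); [assumption | constructor].
- now apply HCP_With.
- now apply HCP_Top.
- eapply hcp_typed_perm; eassumption.
Qed.
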